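(* Let $a\in\mathbb{H}\setminus\mathbb{R}$ and $b\in\mathbb{H}$. A regular polynomial $P\in\mathbb{H}[q_1,q_2]$ vanishes on $\mathbb{S}_a\times\{b\}$ if and only if there exist $P_1\in\mathbb{H}[q_1]$ and $P_2\in\mathbb{H}[q_1,q_2]$ such that $$P(q_1,q_2)=(q_1^2-2\,\mathrm{Re}(a)q_1+|a|^2)*P_1(q_1)+(q_2-b)*P_2(q_1,q_2).$$
   Context: $\mathbb{H}$ denotes the skew field of quaternions. For $a\in\mathbb{H}\setminus\mathbb{R}$, $\mathbb{S}_a=\{cac^{-1} : c\in\mathbb{H},\ |c|=1\}=\{\mathrm{Re}(a)+J|\mathrm{Im}(a)| : J\in\mathbb{H},\ J^2=-1\}$. $\mathbb{H}[q_1,q_2]$ is the set of (slice) regular polynomials in two quaternionic variables, i.e. functions $P:\mathbb{H}^2\to\mathbb{H}$ of the form $P(q_1,q_2)=\sum_{n,m}q_1^nq_2^m a_{n,m}$ (finite sum, $a_{n,m}\in\mathbb{H}$ on the right, evaluated in exactly this order at arbitrary points of $\mathbb{H}^2$). $\mathbb{H}[q_1]$ is the subset of those involving only $q_1$. The $*$-product is the biadditive extension of $(q_1^nq_2^ma)*(q_1^rq_2^sb)=q_1^{n+r}q_2^{m+s}ab$. *)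

(* Defs.v *)
From HB Require Import structures.
From mathcomp Require Import all_boot all_order all_algebra ring lra.
From mathcomp Require Import classical_sets reals.

Set Implicit Arguments.
Unset Strict Implicit.
Unset Printing Implicit Defensive.

Import Order.TTheory GRing.Theory Num.Theory.
Local Open Scope ring_scope.

(* [Quat x y z w] is the quaternion x + y i + z j + w k. *)
Record quat (R : Type) : Type := Quat { qre : R; qim1 : R; qim2 : R; qim3 : R }.
Arguments Quat {R}.

Section QuatChoice.
Variable R : Type.

Definition prod_of_quat (q : quat R) : R * R * R * R :=
  (qre q, qim1 q, qim2 q, qim3 q).
Definition quat_of_prod (p : R * R * R * R) : quat R :=
  let: (x, y, z, w) := p in Quat x y z w.
Lemma prod_of_quatK : cancel prod_of_quat quat_of_prod. Proof. by case. Qed.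

End QuatChoice.

HB.instance Definition _ (R : choiceType) :=
  Choice.copy (quat R) (can_type (@prod_of_quatK R)).

Section QuatRing.
Variable R : realFieldType.
Implicit Types p q : quat R.

Definition addq p q : quat R :=
  Quat (qre p + qre q) (qim1 p + qim1 q) (qim2 p + qim2 q) (qim3 p + qim3 q).
Definition oppq p : quat R := Quat (- qre p) (- qim1 p) (- qim2 p) (- qim3 p).

Lemma addqA : associative addq.
Proof. by move=> p q r; rewrite /addq /= !addrA. Qed.
Lemma addqC : commutative addq.
Proof. by move=> p q; congr Quat; rewrite addrC. Qed.
Lemma add0q : left_id (Quat 0 0 0 0) addq.
Proof. by case=> x y z w; rewrite /addq /= !add0r. Qed.
Lemma addNq : left_inverse (Quat 0 0 0 0) oppq addq.
Proof. by move=> p; rewrite /addq /= !addNr. Qed.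

HB.instance Definition _ := GRing.isZmodule.Build (quat R) addqA addqC add0q addNq.

(* Hamilton's product: i^2 = j^2 = k^2 = ijk = -1. *)
Definition mulq p q : quat R :=
  Quat (qre p * qre q - qim1 p * qim1 q - qim2 p * qim2 q - qim3 p * qim3 q)
       (qre p * qim1 q + qim1 p * qre q + qim2 p * qim3 q - qim3 p * qim2 q)
       (qre p * qim2 q - qim1 p * qim3 q + qim2 p * qre q + qim3 p * qim1 q)
       (qre p * qim3 q + qim1 p * qim2 q - qim2 p * qim1 q + qim3 p * qre q).

Lemma mulqA : associative mulq.
Proof. by move=> p q r; congr Quat => /=; ring. Qed.
Lemma mul1q : left_id (Quat 1 0 0 0) mulq.
Proof. by case=> x y z w; congr Quat => /=; ring. Qed.
Lemma mulq1 : right_id (Quat 1 0 0 0) mulq.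
Proof. by case=> x y z w; congr Quat => /=; ring. Qed.
Lemma mulqDl : left_distributive mulq +%R.
Proof. by move=> p q r; congr Quat => /=; ring. Qed.
Lemma mulqDr : right_distributive mulq +%R.
Proof. by move=> p q r; congr Quat => /=; ring. Qed.
Lemma oneq_neq0 : Quat 1 0 0 0 != 0 :> quat R.
Proof. by apply/eqP => -[] /eqP; rewrite oner_eq0. Qed.

HB.instance Definition _ :=
  GRing.Zmodule_isNzRing.Build (quat R) mulqA mul1q mulq1 mulqDl mulqDr oneq_neq0.

Definition normsq q : R := qre q ^+ 2 + qim1 q ^+ 2 + qim2 q ^+ 2 + qim3 q ^+ 2.

Lemma normsq_eq0 q : (normsq q == 0) = (q == 0).
Proof.
case: q => x y z w; rewrite /normsq /= !paddr_eq0 ?addr_ge0 ?sqr_ge0 // !sqrf_eq0.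
by apply/idP/eqP => [/andP[/andP[/andP[/eqP-> /eqP->] /eqP->] /eqP->] | [-> -> -> ->]];
  rewrite ?eqxx.
Qed.

(* [q^-1 = conj q / |q|^2]; at [q = 0] it is [0]. *)
Definition invq q : quat R :=
  Quat (qre q / normsq q) (- qim1 q / normsq q)
       (- qim2 q / normsq q) (- qim3 q / normsq q).

Lemma mulVq : {in predC1 0, left_inverse 1 invq *%R}.
Proof.
move=> q; rewrite inE /= -normsq_eq0 => q0.
by congr Quat; rewrite /= /normsq in q0 *; field.
Qed.
Lemma mulqV : {in predC1 0, right_inverse 1 invq *%R}.
Proof.
move=> q; rewrite inE /= -normsq_eq0 => q0.
by congr Quat; rewrite /= /normsq in q0 *; field.
Qed.
Lemma unitqP p q : q * p = 1 /\ p * q = 1 -> predC1 0 p.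
Proof.
case=> qp1 _; apply/eqP => p0; move: qp1.
by rewrite p0 mulr0 => /esym/eqP; rewrite oner_eq0.
Qed.
Lemma invq_out : {in [predC predC1 0], invq =1 id}.
Proof.
by move=> q; rewrite !inE negbK => /eqP->; congr Quat; rewrite /= ?oppr0 mul0r.
Qed.

HB.instance Definition _ :=
  GRing.NzRing_hasMulInverse.Build (quat R) mulVq mulqV unitqP invq_out.

Lemma unitqE q : (q \is a GRing.unit) = (q != 0). Proof. by []. Qed.

Definition quat_of_real (x : R) : quat R := Quat x 0 0 0.

End QuatRing.

Notation "x %:H" := (quat_of_real x) (at level 2, format "x %:H") : ring_scope.

Definition qnorm (R : realType) (q : quat R) : R := Num.sqrt (normsq q).

Definition qsphere (R : realType) (a : quat R) : set (quat R) :=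
  [set c * a * c^-1 | c in [set c : quat R | qnorm c = 1]]%classic.

(* A regular polynomial sum q1^n q2^m a_{n,m} is encoded by its coefficients:
   the outer indeterminate is q2, the inner one is q1, and [a_{n,m} = P`_m`_n].
   Indeterminates of [{poly _}] commute with the coefficients, so the ring
   product of [{poly {poly quat R}}] is the *-product ([starM]).  [horner] puts
   the coefficients on the left, hence the separate evaluation [reg_eval]; a
   regular polynomial is determined by the function it induces ([reg_eval_inj]). *)
Notation regpoly1 R := {poly quat R}.
Notation regpoly2 R := {poly {poly quat R}}.

Definition reg_eval (R : realType) (P : regpoly2 R) (q1 q2 : quat R) : quat R :=
  \sum_(m < size P) \sum_(n < size P`_m) q1 ^+ n * q2 ^+ m * P`_m`_n.

Definition regmon (R : realType) (n m : nat) (a : quat R) : regpoly2 R :=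
  (a *: 'X^n) *: 'X^m.

Lemma coef_regmon (R : realType) n m (a : quat R) m' n' :
  (regmon n m a)`_m'`_n' = if (m' == m) && (n' == n) then a else 0.
Proof.
rewrite /regmon coefZ coefXn; case: eqP => _ /=; last by rewrite mulr0 coef0.
by rewrite mulr1 coefZ coefXn; case: eqP => _; rewrite ?mulr1 ?mulr0.
Qed.

Lemma starM (R : realType) n m r s (a b : quat R) :
  regmon n m a * regmon r s b = regmon (n + r) (m + s) (a * b).
Proof.
have monM (S : nzRingType) (u v : S) i j :
    (u *: 'X^i) * (v *: 'X^j) = (u * v) *: 'X^(i + j) :> {poly S}.
  rewrite -!mul_polyC polyCM exprD -!mulrA; congr (_ * _).
  by rewrite !mulrA (commr_polyXn v%:P i).
by rewrite /regmon !monM.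
Qed.

Section EvalInj.
Variable R : realType.

Lemma reg_eval_widen (P : regpoly2 R) (M N : nat) q1 q2 :
  (size P <= M)%N -> (forall m, size (P`_m)%R <= N)%N ->
  reg_eval P q1 q2 = \sum_(m < M) \sum_(n < N) q1 ^+ n * q2 ^+ m * P`_m`_n.
Proof.
move=> hM hN; rewrite /reg_eval (big_ord_widen _ (fun m : nat =>
  \sum_(n < size P`_m) q1 ^+ n * q2 ^+ m * P`_m`_n) hM) big_mkcond /=.
apply: eq_bigr => m _; case: ltnP => hm; last first.
  by rewrite [P`_m]nth_default // big1 // => n _; rewrite coef0 mulr0.
rewrite (big_ord_widen _ (fun n : nat => q1 ^+ n * q2 ^+ m * P`_m`_n) (hN m)).
rewrite big_mkcond /=; apply: eq_bigr => n _; case: ltnP => // hn.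
by rewrite [P`_m`_n]nth_default // mulr0.
Qed.

Lemma reg_eval_bound (P : regpoly2 R) : exists N, forall m, (size (P`_m)%R <= N)%N.
Proof.
exists (\max_(m < size P) size (P`_m)%R)%N => m.
case: (ltnP m (size P)) => hm; first exact: (leq_bigmax (Ordinal hm)).
by rewrite [P`_m]nth_default // size_poly0.
Qed.

Lemma quat_of_realX (x : R) n : x%:H ^+ n = (x ^+ n)%:H.
Proof.
elim: n => [|n IH]; first by [].
by rewrite !exprS IH; congr Quat => /=; ring.
Qed.

Lemma real_poly_eq0 N (c : nat -> R) :
  (forall x : R, \sum_(n < N) x ^+ n * c n = 0) -> forall n, (n < N)%N -> c n = 0.
Proof.
move=> h n hn; pose p := \poly_(i < N) c i.
suff p0 : p = 0 by have := coef_poly N c n; rewrite hn -/p p0 coef0.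
apply: (@roots_geq_poly_eq0 R p [seq i%:R | i <- iota 0 N]).
- apply/allP => _ /mapP[i _ ->]; rewrite /root horner_poly; apply/eqP.
  by rewrite -[RHS](h i%:R); apply: eq_bigr => j _; rewrite mulrC.
- by rewrite map_inj_uniq ?iota_uniq // => i j /eqP; rewrite eqr_nat => /eqP.
- by rewrite size_map size_iota size_poly.
Qed.

Lemma quat_poly_eq0 N (c : nat -> quat R) :
  (forall x : R, \sum_(n < N) x%:H ^+ n * c n = 0) ->
  forall n, (n < N)%N -> c n = 0.
Proof.
move=> h n hn.
have comp (f : quat R -> R) : f 0 = 0 -> (forall p q, f (p + q) = f p + f q) ->
    (forall x q, f (x%:H * q) = x * f q) -> f (c n) = 0.
  move=> f0 fD fM; apply: (@real_poly_eq0 N (f \o c)) => // x /=.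
  have := congr1 f (h x); rewrite f0 (big_morph f fD f0) => H.
  by rewrite -[RHS]H; apply: eq_bigr => i _; rewrite quat_of_realX fM.
have h0 : qre (c n) = 0 by apply: comp => // x q /=; ring.
have h1 : qim1 (c n) = 0 by apply: comp => // x q /=; ring.
have h2 : qim2 (c n) = 0 by apply: comp => // x q /=; ring.
have h3 : qim3 (c n) = 0 by apply: comp => // x q /=; ring.
by case: (c n) h0 h1 h2 h3 => x y z w /= -> -> -> ->.
Qed.

Theorem reg_eval_inj (P Q : regpoly2 R) :
  (forall q1 q2, reg_eval P q1 q2 = reg_eval Q q1 q2) -> P = Q.
Proof.
move=> h; have [NP hP] := reg_eval_bound P; have [NQ hQ] := reg_eval_bound Q.
pose N := maxn NP NQ; pose M := maxn (size P) (size Q).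
have E x y : \sum_(m < M) y%:H ^+ m *
    (\sum_(n < N) x%:H ^+ n * (P`_m`_n - Q`_m`_n)) = 0.
  have := h x%:H y%:H; rewrite (@reg_eval_widen P M N) ?leq_maxl //; last first.
    by move=> m; apply: leq_trans (hP m) (leq_maxl _ _).
  rewrite (@reg_eval_widen Q M N) ?leq_maxr //; last first.
    by move=> m; apply: leq_trans (hQ m) (leq_maxr _ _).
  move/eqP; rewrite -subr_eq0 -sumrB => /eqP H.
  rewrite -[RHS]H; apply: eq_bigr => m _.
  rewrite -sumrB mulr_sumr; apply: eq_bigr => n _; rewrite -mulrBr mulrA.
  by congr (_ * _); rewrite !quat_of_realX; congr Quat => /=; ring.
apply/polyP => m; case: (ltnP m M) => [hm|]; last first.
  by rewrite geq_max => /andP[? ?]; rewrite !nth_default.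
apply/polyP => n; case: (ltnP n N) => [hn|]; last first.
  rewrite geq_max => /andP[hNP hNQ].
  rewrite [LHS]nth_default ?[RHS]nth_default //.
  - exact: leq_trans (hQ m) hNQ.
  - exact: leq_trans (hP m) hNP.
apply/eqP; rewrite -subr_eq0; apply/eqP.
apply: (@quat_poly_eq0 N (fun n => P`_m`_n - Q`_m`_n)) => // x.
exact: (@quat_poly_eq0 M
  (fun m => \sum_(n < N) x%:H ^+ n * (P`_m`_n - Q`_m`_n)) (E x)).
Qed.

End EvalInj.

(* Main.v *)
Require Import Defs.
From mathcomp Require Import all_boot all_order all_algebra.
From mathcomp Require Import classical_sets reals.
From mathcomp Require Import ring.

Set Implicit Arguments.
Unset Strict Implicit.
Unset Printing Implicit Defensive.

Import GRing.Theory Num.Theory.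
Local Open Scope ring_scope.
Local Open Scope classical_set_scope.

(** Evaluating a regular polynomial with the coefficients on the right is an
    iterated one-variable evaluation [leval]: substitute [q2] for the outer
    indeterminate, then [q1] for the inner one ([reg_eval_leval]).  Although
    [leval] is not multiplicative over a noncommutative ring, the polynomials
    that it kills at a given point form a right ideal ([leval_mul_eq0]).

    Over any ring this ideal is generated by ['X - x%:P] on the left
    ([left_remainder]).  Applied to the coefficient ring H[q1] and to [b], this
    writes P as (q2 - b) * P2 + r(q1), where r(q1) = P(q1, b) for every q1; so P
    vanishes on S_a x {b} exactly when r vanishes on S_a.

    Next, r is divided by D = q1^2 - 2 Re(a) q1 + |a|^2 ([left_quadratic_div]).
    D vanishes on S_a because it does at [a] and has central coefficients
    ([char_poly_sphere]).  Hence on S_a the polynomial r takes the values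
    q c + d of its remainder.  As [a] is not real, it is not central, so S_a has
    at least two points; a remainder q c + d that vanishes at two points is zero
    because H is a division ring ([affine_vanish_sphere]). *)

(** * Evaluation with coefficients on the right *)

Section LeftEvaluation.
Variable S : nzRingType.
Implicit Types (p q : {poly S}) (x c : S).

Definition leval p x : S := \sum_(i < size p) x ^+ i * p`_i.

Lemma leval_widen p x N :
  (size p <= N)%N -> leval p x = \sum_(i < N) x ^+ i * p`_i.
Proof.
move=> hN; rewrite /leval (big_ord_widen _ (fun i : nat => x ^+ i * p`_i) hN).
rewrite big_mkcond /=; apply: eq_bigr => i _; case: ltnP => // hi.
by rewrite nth_default // mulr0.
Qed.

Lemma levalD p q x : leval (p + q) x = leval p x + leval q x.
Proof.
rewrite (leval_widen x (size_polyD p q)) (leval_widen x (leq_maxl _ (size q))).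
rewrite (leval_widen x (leq_maxr (size p) _)) -big_split /=.
by apply: eq_bigr => i _; rewrite coefD mulrDr.
Qed.

Lemma levalC c x : leval c%:P x = c.
Proof.
by rewrite (leval_widen x (size_polyC_leq1 c)) big_ord1 expr0 mul1r coefC.
Qed.

Lemma levalMX p x : leval (p * 'X) x = x * leval p x.
Proof.
have hs : (size (p * 'X)%R <= (size p).+1)%N.
  by apply: leq_trans (size_polyMleq _ _) _; rewrite size_polyX addn2.
rewrite (leval_widen x hs) big_ord_recl coefMX mulr0 add0r mulr_sumr.
by apply: eq_bigr => i _; rewrite coefMX /= exprS mulrA.
Qed.

Lemma levalX x : leval 'X x = x.
Proof. by rewrite -['X]mul1r levalMX levalC mulr1. Qed.

Lemma levalMC p c x : leval (p * c%:P) x = leval p x * c.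
Proof.
have hs : (size (p * c%:P)%R <= size p)%N.
  apply: leq_trans (size_polyMleq _ _) _.
  by have := size_polyC_leq1 c; case: (size _) => [|[]] // _;
    rewrite ?addn0 ?addn1 // leq_pred.
rewrite (leval_widen x hs) mulr_suml.
by apply: eq_bigr => i _; rewrite coefMC mulrA.
Qed.

(** Induction on [q]: multiplying on the right by ['X] or by a constant
    multiplies the value by [x] on the left or by the constant on the right. *)
Lemma leval_mul_eq0 p q x : leval p x = 0 -> leval (p * q) x = 0.
Proof.
move=> px0; elim/poly_ind: q => [|q c IH]; first by rewrite mulr0 levalC.
by rewrite mulrDr mulrA levalD levalMX IH levalMC px0 mul0r mulr0 addr0.
Qed.

Lemma leval_XsubC x : leval ('X - x%:P) x = 0.
Proof. by rewrite -polyCN levalD levalX levalC subrr. Qed.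

(** * Division on the left *)

(** The mirror image of [factor_theorem]: the coefficients of [leval] are on the
    right, so the linear factor has to be on the left.  Existence of a constant
    remainder is by induction on [p]; its value is then forced by evaluation. *)
Lemma left_remainder p x :
  exists q, p = ('X - x%:P) * q + (leval p x)%:P.
Proof.
suff [q [r Ep]] : exists q r, p = ('X - x%:P) * q + r%:P.
  exists q; suff -> : leval p x = r by [].
  by rewrite Ep levalD (leval_mul_eq0 _ (leval_XsubC x)) add0r levalC.
elim/poly_ind: p => [|p c [q [r ->]]].
  by exists 0, 0; rewrite mulr0 addr0.
exists (q * 'X + r%:P), (x * r + c).
rewrite mulrDl [RHS]addrC mulrDr [RHS]addrCA -mulrA -addrA; congr (_ + _).
rewrite [r%:P * 'X]commr_polyX mulrBl polyCD polyCM.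
by rewrite [RHS]addrC addrA subrK.
Qed.

(** Division by a monic quadratic D, by induction on [p]: a remainder X c + d
    multiplied by X is reduced with X^2 c = D c + X (t c) - n c, which uses only
    that X commutes with constants. *)
Lemma left_quadratic_div (t n : S) p :
  exists q c d, p = ('X^2 - t *: 'X + n%:P) * q + ('X * c%:P + d%:P).
Proof.
set D := _ + n%:P.
elim/poly_ind: p => [|p e [q [c [d ->]]]].
  by exists 0, 0, 0; rewrite polyC0 !mulr0 !addr0.
exists (q * 'X + c%:P), (t * c + d), (e - n * c).
rewrite mulrDl [D * (_ + _)]mulrDr -!mulrA -!addrA; congr (_ + _).
rewrite mulrDl -!mulrA [c%:P * 'X]commr_polyX [d%:P * 'X]commr_polyX.
rewrite /D !mulrDl mulNr -mul_polyC.
rewrite [t%:P * 'X]commr_polyX expr2 -!mulrA.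
rewrite polyCB !polyCD !polyCM mulrDr.
set u := 'X * ('X * c%:P); set v := 'X * (t%:P * c%:P); set w := n%:P * c%:P.
rewrite -!addrA; congr (_ + _).
by rewrite [w + _]addrCA addKr [RHS]addrC -!addrA addNr addr0.
Qed.

End LeftEvaluation.

Lemma reg_eval_leval (R : realType) (P : regpoly2 R) (x y : quat R) :
  reg_eval P x y = leval (leval P y%:P) x.
Proof.
have [N hN] := reg_eval_bound P.
rewrite (@reg_eval_widen R P (size P) N) // exchange_big /=.
rewrite (@leval_widen _ (leval P y%:P) x N); last first.
  apply: (leq_trans (size_sum _ _ _)); apply/bigmax_leqP => m _.
  rewrite -polyC_exp mul_polyC; apply: leq_trans (hN m).
  exact: size_scale_leq.
apply: eq_bigr => n _; rewrite /leval coef_sum mulr_sumr.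
by apply: eq_bigr => m _; rewrite -polyC_exp coefCM mulrA.
Qed.

(** * The sphere of a quaternion *)

Section Sphere.
Variable R : realType.
Implicit Types a c d q u : quat R.

Definition char_poly_quat a : regpoly1 R :=
  'X^2 - (2 * qre a)%:H *: 'X + (qnorm a ^+ 2)%:H%:P.

Lemma real_quat_central (x : R) q : x%:H * q = q * x%:H.
Proof. by congr Quat => /=; ring. Qed.

Lemma qnorm1_unit u : qnorm u = 1 -> u \is a GRing.unit.
Proof.
move=> u1; rewrite unitqE -normsq_eq0; apply/eqP => u0.
by move: u1; rewrite /qnorm u0 sqrtr0 => /eqP; rewrite eq_sym oner_eq0.
Qed.

Lemma leval_char_poly a q :
  leval (char_poly_quat a) q
    = q * q - q * (2 * qre a)%:H + (qnorm a ^+ 2)%:H.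
Proof.
rewrite /char_poly_quat -mul_polyC commr_polyX -mulrN -polyCN expr2.
by rewrite !levalD levalMX levalMC levalX levalC mulrN.
Qed.

(** The polynomial has real, hence central, coefficients, so its values at [u a u^-1] and
    at [a] are conjugate. *)
Lemma char_poly_sphere a q : qsphere a q -> leval (char_poly_quat a) q = 0.
Proof.
case=> u /= /qnorm1_unit uU <-; rewrite leval_char_poly.
have -> : u * a * u^-1 * (u * a * u^-1) = u * (a * a) * u^-1.
  by rewrite !mulrA mulrVK.
have -> : u * a * u^-1 * (2 * qre a)%:H = u * (a * (2 * qre a)%:H) * u^-1.
  by rewrite -!mulrA real_quat_central.
have -> : (qnorm a ^+ 2)%:H = u * (qnorm a ^+ 2)%:H * u^-1.
  by rewrite -real_quat_central mulrK.
rewrite -mulrBl -mulrBr -mulrDl -mulrDr.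
suff -> : a * a - a * (2 * qre a)%:H + (qnorm a ^+ 2)%:H = 0.
  by rewrite mulr0 mul0r.
have -> : qnorm a ^+ 2 = normsq a.
  by rewrite sqr_sqrtr // /normsq !addr_ge0 ?sqr_ge0.
by congr Quat; rewrite /= /normsq; ring.
Qed.

(** The units i and j already detect the centre of H. *)
Lemma commute_units_real a :
  (forall u, qnorm u = 1 -> u * a = a * u) -> exists x : R, a = x%:H.
Proof.
move=> comm_a.
have normi : qnorm (Quat 0 1 0 0 : quat R) = 1.
  by rewrite /qnorm /normsq /= expr0n expr1n /= !addr0 add0r sqrtr1.
have normj : qnorm (Quat 0 0 1 0 : quat R) = 1.
  by rewrite /qnorm /normsq /= expr0n expr1n /= !addr0 add0r sqrtr1.
have zero2 (x : R) : - x = x -> x = 0.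
  by move=> /eqP; rewrite eqNr => /eqP.
exists (qre a); case: a comm_a => x y z w comm_a /=.
have := comm_a _ normi; have := comm_a _ normj.
case=> _ _ _; rewrite !(mul0r, mulr0, mul1r, mulr1, add0r, subr0, addr0, sub0r).
move=> /zero2 -> [_ _].
rewrite !(mul0r, mulr0, mul1r, mulr1, add0r, subr0, addr0, sub0r).
by move=> /zero2 -> /esym/zero2 ->.
Qed.

Lemma qsphere_refl a : qsphere a a.
Proof.
exists 1; last by rewrite mul1r invr1 mulr1.
by rewrite /= /qnorm /normsq /= expr0n expr1n /= !addr0 sqrtr1.
Qed.

(** Subtracting the values at [a] and at [u a u^-1] gives
    (u a u^-1 - a) c = 0; if c were invertible, [a] would commute with every
    unit quaternion. *)
Lemma affine_vanish_sphere a c d :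
  ~ (exists x : R, a = x%:H) ->
  (forall q, qsphere a q -> q * c + d = 0) -> c = 0 /\ d = 0.
Proof.
move=> anR vanish; have Ea := vanish _ (qsphere_refl a).
suff c0 : c = 0 by split=> //; move: Ea; rewrite c0 mulr0 add0r.
apply/eqP; apply: contra_notT anR => c_neq0; apply: commute_units_real => u u1.
have Eu : u * a * u^-1 * c + d = 0 by apply: vanish; exists u.
have /(mulIr (_ : c \is a GRing.unit)) : u * a * u^-1 * c = a * c.
  by apply: (addIr d); rewrite Eu Ea.
by rewrite unitqE => /(_ c_neq0) /(canRL (mulrVK (qnorm1_unit u1))).
Qed.

End Sphere.

Theorem proposition3p18 (R : realType) (a b : quat R)
    (ha : ~ exists x : R, a = x%:H) (P : regpoly2 R) :
  (forall q1 q2 : quat R,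
     (qsphere a `*` [set b]) (q1, q2) -> reg_eval P q1 q2 = 0) <->
  exists (P1 : regpoly1 R) (P2 : regpoly2 R),
    P = ('X^2 - (2 * qre a)%:H *: 'X + (qnorm a ^+ 2)%:H%:P)%:P * P1%:P
        + ('X - b%:P%:P) * P2.
Proof.
rewrite -/(char_poly_quat a); split=> [vanish | [P1 [P2 ->]] q1 q2 [/= aq1 ->]].
  have [P2 EP] := left_remainder P b%:P.
  have [P1 [c [d Er]]] :=
    left_quadratic_div (2 * qre a)%:H (qnorm a ^+ 2)%:H (leval P b%:P).
  rewrite -/(char_poly_quat a) in Er.
  have [q aq|c0 d0] := @affine_vanish_sphere R a c d ha.
    have := vanish q b (conj aq erefl); rewrite reg_eval_leval Er levalD.
    rewrite (leval_mul_eq0 _ (char_poly_sphere aq)) add0r.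
    by rewrite levalD levalMC levalX levalC.
  exists P1, P2; rewrite [LHS]EP Er c0 d0 polyC0 mulr0 !addr0 polyCM.
  exact: addrC.
rewrite reg_eval_leval levalD (leval_mul_eq0 _ (leval_XsubC _)) addr0.
by rewrite -polyCM levalC (leval_mul_eq0 _ (char_poly_sphere aq1)).
Qed.
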